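(* Let $G=(V,A,E)$ be a mixed graph and $\overrightarrow{E}$ a reference orientation of $E$. Then the convex hull of $\mathrm{SCR}(G;\overrightarrow{E})$ is the set of $x\in\mathbb{R}^{\overrightarrow{E}}$ satisfying $$\sum_{a\in\delta^+_{\overrightarrow{E}}(U)}x_a+\sum_{b\in\delta^-_{\overrightarrow{E}}(U)}(1-x_b)\geq1\quad\text{for all }U\subsetneq V,\ U\neq\emptyset,\ \delta^-_A(U)=\emptyset,$$ and $\mathbf{0}\leq x\leq\mathbf{1}$. In particular, the set-system $\mathrm{SCR}(G;\overrightarrow{E})$ is cube-ideal.
   Context: A mixed graph $G=(V,A,E)$ has arcs $A$ (directed) and edges $E$ (undirected). A $G$-strong orientation is an orientation of $E$ which together with $A$ yields a strongly connected digraph. Given a reference orientation $\overrightarrow{E}$ of $E$, $\mathrm{SCR}(G;\overrightarrow{E})$ is the set of $x\in\{0,1\}^{\overrightarrow{E}}$ such that reversing the arcs $\{a\in\overrightarrow{E}:x_a=1\}$ of $\overrightarrow{E}$ gives a $G$-strong orientation. $\delta^+_X(U)$ and $\delta^-_X(U)$ denote the arcs of $X$ leaving and entering $U$. A set-system $S\subseteq\{0,1\}^m$ is cube-ideal if its convex hull is the solution set of a finite family of capacity inequalities ($x_i\geq0$, $x_i\leq1$) and GSC inequalities $\sum_{i\in I}x_i+\sum_{j\in J}(1-x_j)\geq1$ with $I,J$ disjoint. *)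

(* Defs.v *)
From HB Require Import structures.
From mathcomp Require Import all_boot all_order all_algebra.
From mathcomp Require Import boolp classical_sets reals.

Set Implicit Arguments.
Unset Strict Implicit.
Unset Printing Implicit Defensive.

Import Order.TTheory GRing.Theory Num.Theory.
Local Open Scope ring_scope.

(* Finite digraphs; parallel arcs and loops are allowed. *)
Record digraph (V : finType) := Digraph {
  arc : finType;
  tail : arc -> V;
  head : arc -> V }.

Definition arc_rel (V : finType) (D : digraph V) : rel V :=
  fun u v => [exists a : arc D, (tail a == u) && (head a == v)].

Definition strongly_connected (V : finType) (D : digraph V) : Prop :=
  forall u v : V, connect (arc_rel D) u v.

Definition delta_out (V : finType) (D : digraph V) (U : {set V}) :
  {set arc D} := [set a : arc D | (tail a \in U) && (head a \notin U)]%SET.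

Definition delta_in (V : finType) (D : digraph V) (U : {set V}) :
  {set arc D} := [set a : arc D | (tail a \notin U) && (head a \in U)]%SET.

Definition digraph_union (V : finType) (D1 D2 : digraph V) : digraph V :=
  @Digraph V (arc D1 + arc D2)%type
    (fun a => match a with inl a1 => tail a1 | inr a2 => tail a2 end)
    (fun a => match a with inl a1 => head a1 | inr a2 => head a2 end).

(* An undirected edge has a set of one (loop) or two ends; distinct edges may
   have the same ends. *)
Record mixed_graph := MixedGraph {
  vertex : finType;
  arcs : digraph vertex;
  edge : finType;
  ends : edge -> {set vertex};
  ends_card : forall e, (0 < #|ends e| <= 2)%N }.

Record orientation (G : mixed_graph) := Orientation {
  otail : edge G -> vertex G;
  ohead : edge G -> vertex G;
  oends : forall e, [set otail e; ohead e]%SET = ends e }.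

(* The arc set of an orientation is indexed by the edges of G. *)
Definition oriented (G : mixed_graph) (o : orientation G) :
  digraph (vertex G) := Digraph (@otail G o) (@ohead G o).

Definition strong_orientation (G : mixed_graph) (o : orientation G) : Prop :=
  strongly_connected (digraph_union (arcs G) (oriented o)).

Section Reverse.
Variables (G : mixed_graph) (o : orientation G) (F : {set edge G}).

Definition rev_tail (e : edge G) := if e \in F then ohead o e else otail o e.
Definition rev_head (e : edge G) := if e \in F then otail o e else ohead o e.

Lemma rev_ends (e : edge G) : [set rev_tail e; rev_head e]%SET = ends e.
Proof.
rewrite /rev_tail /rev_head; case: ifP => _; last exact: oends.
by rewrite finset.setUC; exact: oends.
Qed.

Definition reverse : orientation G := Orientation rev_ends.

End Reverse.

(* SCR(G; o), as a subset of {0,1}^E with 1 read as true. *)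
Definition SCR (G : mixed_graph) (o : orientation G) :
    set {ffun edge G -> bool} :=
  [set x | strong_orientation (reverse o [set a | x a]%SET)]%classic.

Definition vec01 (R : realType) (T : finType) (x : {ffun T -> bool}) :
  {ffun T -> R} := [ffun i => (x i)%:R].

Definition convex_hull (R : realType) (T : finType) (S : set {ffun T -> R}) :
    set {ffun T -> R} :=
  [set x | exists (n : nat) (w : 'I_n -> R) (p : 'I_n -> {ffun T -> R}),
    [/\ forall k, 0 <= w k, \sum_k w k = 1, forall k, S (p k)
      & x = [ffun i => \sum_k w k * p k i]]]%classic.

Inductive cube_ineq (T : finType) :=
| Nonneg of T
| AtMost1 of T
| GSC (I1 J1 : {set T}) of [disjoint I1 & J1].

Definition satisfies (R : realType) (T : finType) (x : {ffun T -> R})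
    (c : cube_ineq T) : bool :=
  match c with
  | Nonneg i => 0 <= x i
  | AtMost1 i => x i <= 1
  | GSC I1 J1 _ => 1 <= \sum_(i in I1) x i + \sum_(j in J1) (1 - x j)
  end.

Definition cube_ideal (R : realType) (T : finType)
    (S : set {ffun T -> bool}) : Prop :=
  exists F : seq (cube_ineq T),
    convex_hull (@vec01 R T @` S)%classic =
    [set x : {ffun T -> R} | all (satisfies x) F]%classic.

(* Main.v *)
(** Read a point [x] of the polytope as a fractional orientation; a vertex set entered
    by no arc of [A] must have inflow at least 1.  Inflow is submodular, so the sets with
    inflow exactly 1 form a crossing family.  The inflow of [U] differs from the total
    fractional indegree of [U] by an integer, and uncrossing shows that the total
    indegree of each atom of the crossing family is an integer.  Hence no atom is
    left by exactly one edge with [0 < x a < 1]: contracting the atoms gives a graph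
    without vertices of degree one, so if there is a fractional edge then some nonzero
    circulation is supported on the fractional edges.  It changes the inflow of no tight
    set, so [x] can be moved along it in both directions, which exhibits [x] as a convex
    combination of points satisfying more constraints with equality.  Points without
    fractional edges are the strong orientations. *)

From mathcomp Require Import all_boot all_order all_algebra.
From mathcomp Require classical_sets.
From mathcomp Require Import reals zify ring lra.
Require Import Defs.

Set Implicit Arguments.
Unset Strict Implicit.
Unset Printing Implicit Defensive.

Import Order.TTheory GRing.Theory Num.Theory.
Local Open Scope ring_scope.

(** * Crossing families and the weights of their atoms *)

Definition crossing_family (V : finType) (T : {set {set V}}) : Prop :=
  forall U W : {set V}, U \in T -> W \in T ->
    U :&: W != set0 -> U :|: W != setT -> (U :&: W \in T) && (U :|: W \in T).

Definition atom (V : finType) (T : {set {set V}}) (v : V) : {set V} :=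
  [set u | [forall W in T, (u \in W) == (v \in W)]].

Lemma in_atomP (V : finType) (T : {set {set V}}) (u v : V) :
  reflect {in T, forall W : {set V}, (u \in W) = (v \in W)} (u \in atom T v).
Proof.
rewrite inE; apply: (iffP forall_inP) => h W WT; first exact/eqP/h.
by rewrite h.
Qed.

Lemma atom_eq (V : finType) (T : {set {set V}}) (u v : V) :
  (u \in atom T v) = (atom T u == atom T v).
Proof.
apply/in_atomP/eqP => [h | eq_uv].
  by apply/setP=> w; apply/in_atomP/in_atomP => hw W WT; rewrite hw // h.
by apply/in_atomP; rewrite -eq_uv; apply/in_atomP.
Qed.

Section AtomWeight.

Variables (V : finType) (T : {set {set V}}) (v : V).
Hypothesis crossT : crossing_family T.

(* Its members cover the complement of the atom of [v]; uncrossing turns it into a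
   disjoint cover. *)
Definition avoiding : {set {set V}} :=
  [set X : {set V} | (v \notin X) && ((X \in T) || (~: X \in T))].

Lemma cover_avoiding : cover avoiding = ~: atom T v.
Proof.
apply/setP=> u; rewrite in_setC; apply/bigcupP/idP => [[X] | ].
  rewrite inE => /andP[vX /orP[XT|XT]] uX; apply/negP => /in_atomP /(_ _ XT).
    by rewrite uX (negbTE vX).
  by rewrite !inE uX vX.
rewrite inE negb_forall => /existsP[W]; rewrite negb_imply => /andP[WT].
case: (boolP (v \in W)) => vW uW.
  exists (~: W); first by rewrite !inE vW setCK WT orbT.
  by move: uW; rewrite inE; case: (u \in W).
exists W; first by rewrite !inE vW WT.
by move: uW; case: (u \in W).
Qed.

(** If [A] and [B] both lie in [T], or both have their complements in [T], crossing puts [A :|: B]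
    itself in [avoiding]; that [v] lies outside both sets supplies the side condition. In the mixed
    case, with [C] and [~: D] in [T], the pair [C :\: D], [D] does the job unless one set contains
    the other. The total size drops by at least [#|A :&: B|], which makes repeated uncrossing
    terminate. *)
Lemma avoiding_uncross (A B : {set V}) :
  A \in avoiding -> B \in avoiding -> A :&: B != set0 ->
  exists Q : {set {set V}}, [/\ Q \subset avoiding, cover Q = A :|: B
    & (\sum_(X in Q) #|X| < #|A| + #|B|)%N].
Proof.
move=> hA hB hAB.
have gtI : (0 < #|A :&: B|)%N by rewrite card_gt0.
have cU := cardsUI A B.
have single X : X \in avoiding -> X = A :|: B ->
    exists Q : {set {set V}}, [/\ Q \subset avoiding, cover Q = A :|: B
    & (\sum_(X in Q) #|X| < #|A| + #|B|)%N].
  move=> XC eX; exists [set X]; split; first by rewrite sub1set.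
    by rewrite /cover big_set1.
  by rewrite big_set1 eX; lia.
have mixed C D : C \in avoiding -> D \in avoiding -> C \in T -> ~: D \in T ->
    [/\ C :|: D = A :|: B, (#|C| + #|D| = #|A| + #|B|)%N & C :&: D = A :&: B] ->
    exists Q : {set {set V}}, [/\ Q \subset avoiding, cover Q = A :|: B
    & (\sum_(X in Q) #|X| < #|A| + #|B|)%N].
  move=> hC hD CT DT [eU ec eI].
  have [sCD | nCD] := boolP (C \subset D).
    by apply: (single D) => //; rewrite -eU; apply/esym/setUidPr.
  have [sDC | nDC] := boolP (D \subset C).
    by apply: (single C) => //; rewrite -eU; apply/esym/setUidPl.
  (* The sets [C] and [~: D] cross: they meet because [C] is not inside [D], and their union is not
     everything because [D] is not inside [C]. *)
  have /andP[CDT _] : (C :&: ~: D \in T) && (C :|: ~: D \in T).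
    apply: crossT => //; first by rewrite -setDE setD_eq0.
    apply: contra nDC => /eqP h; rewrite -setD_eq0 setDE.
    by rewrite -[D :&: _]setCK setCI setCK setUC h setCT.
  exists [set C :\: D; D]; split.
  - rewrite subUset !sub1set hD andbT [_ \in avoiding]inE setDE CDT andbT.
    by move: hC; rewrite !inE => /andP[/negbTE->].
  - rewrite /cover bigcup_setU !big_set1 -eU setDE setUIl.
    by rewrite [~: D :|: D]setUC setUCr setIT.
  (* Only an inequality, since the two-element family collapses when [C :\: D] equals [D]. *)
  - have leQ : (\sum_(X in [set C :\: D; D]) #|X| <= #|C :\: D| + #|D|)%N.
      have [-> | ne] := eqVneq (C :\: D) D; last by rewrite big_setU1 ?big_set1 ?inE.
      by rewrite setUid big_set1 leq_addr.
    apply: leq_ltn_trans leQ _; rewrite -ec -(cardsID D C) eI.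
    by rewrite -addnA -[ltnLHS]add0n ltn_add2r.
move: (hA) (hB); rewrite !inE => /andP[vA TA] /andP[vB TB].
have vAB : v \notin A :|: B by rewrite inE negb_or vA.
case/orP: TA => TA; case/orP: TB => TB.
- apply: (single (A :|: B)) => //; rewrite inE vAB.
  suff /andP[_ ->] : (A :&: B \in T) && (A :|: B \in T) by [].
  by apply: crossT => //; apply: contra vAB => /eqP->; rewrite inE.
- exact: (mixed A B).
- by apply: (mixed B A) => //; rewrite setUC setIC addnC.
- apply: (single (A :|: B)) => //; rewrite inE vAB setCU.
  suff /andP[->] : (~: A :&: ~: B \in T) && (~: A :|: ~: B \in T) by rewrite orbT.
  apply: crossT => //; first by apply/set0Pn; exists v; rewrite !inE vA vB.
  by rewrite -setCI -setC0 (inj_eq (@setC_inj V)).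
Qed.

(** Induction on the total size of the members: as long as two distinct members meet,
    [avoiding_uncross] replaces them by a family with the same union and smaller total size. *)
Lemma avoiding_disjoint_cover (P : {set {set V}}) : P \subset avoiding ->
  exists Q : {set {set V}}, [/\ Q \subset avoiding, trivIset Q & cover Q = cover P].
Proof.
have [n] := ubnP (\sum_(X in P) #|X|); elim: n P => // n IHn P ltn sP.
have [tP | ] := boolP (trivIset P); first by exists P.
case: (boolP [exists A in P, exists B in P, (A != B) && (A :&: B != set0)]); last first.
  move=> hn /negP[]; apply/trivIsetP => A B AP BP AB.
  rewrite -setI_eq0; apply: contraNT hn => hI.
  by apply/exists_inP; exists A => //; apply/exists_inP; exists B => //; rewrite AB.
move=> /exists_inP[A AP /exists_inP[B BP /andP[AB hI]]] _.
have [Q [sQ cQ ltQ]] := avoiding_uncross (subsetP sP _ AP) (subsetP sP _ BP) hI.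
set P0 := P :\ A :\ B.
have BP' : B \in P :\ A by rewrite !inE eq_sym AB.
have eP : cover P = A :|: B :|: cover P0.
  rewrite /cover (big_setD1 A) //= (big_setD1 B) //=.
  by rewrite setUA.
have [||Q' [sQ' tQ' cQ']] := IHn (Q :|: P0).
- have leU : (\sum_(X in Q :|: P0) #|X| <= \sum_(X in Q) #|X| + \sum_(X in P0) #|X|)%N.
    rewrite (big_setID Q) /= leq_add //; first by rewrite (setIidPr _) // subsetUl.
    by rewrite setDUl setDv set0U [leqRHS](big_setID Q) /= leq_addl.
  apply: leq_ltn_trans leU _; move: ltn.
  rewrite ltnS (big_setD1 A) //= (big_setD1 B) //= -/P0 addnA; apply: leq_trans.
  by rewrite ltn_add2r.
- rewrite subUset sQ /=; apply: subset_trans sP.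
  by apply: subset_trans (subD1set _ _) (subD1set _ _).
exists Q'; split => //; rewrite cQ' eP -cQ.
by rewrite /cover bigcup_setU.
Qed.

(** A member of [avoiding] has weight in [S], either directly or as the total minus the weight of
    its complement. A disjoint cover of the complement of the atom adds such weights up, and the
    atom is what remains of the total. *)
Lemma atom_weight (M : zmodType) (S : zmodClosed M) (mu : V -> M) :
  {in T, forall U : {set V}, \sum_(u in U) mu u \in S} ->
  \sum_u mu u \in S -> \sum_(u in atom T v) mu u \in S.
Proof.
move=> hT hV.
have hC X : X \in avoiding -> \sum_(u in X) mu u \in S.
  rewrite inE => /andP[_ /orP[/hT //|/hT XT]].
  move: hV; rewrite (bigID (mem X)) /= => hV.
  suff -> : \sum_(u in X) mu u =
     (\sum_(u in X) mu u + \sum_(u | u \notin X) mu u) - \sum_(u in ~: X) mu u.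
    by rewrite rpredB.
  by rewrite [X in _ - X](eq_bigl (fun u => u \notin X)) ?addrK // => u; rewrite inE.
have [Q [sQ tQ cQ]] := avoiding_disjoint_cover (subxx _).
have hQ : \sum_(u in ~: atom T v) mu u \in S.
  rewrite -cover_avoiding -cQ big_trivIset //=.
  by apply: rpred_sum => X /(subsetP sQ) /hC.
move: hV; rewrite (bigID (mem (atom T v))) /= => hV.
rewrite -(rpredDr _ hQ) /=; move: hV; congr (_ + _ \in S).
by apply: eq_bigl => u; rewrite !in_setC.
Qed.

End AtomWeight.

(** * Circulations in graphs without vertices of degree one *)

(** A loop alone carries a circulation. Without loops, every node met by [F] has degree at least 2,
    so there are at most [#|F|] such nodes. The rows of the incidence matrix sum to zero, so its
    rank is less than the number of nodes, hence less than [#|F|]; a nonzero vector of the left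
    kernel is the circulation. *)
Lemma circulation_exists (K : fieldType) (E N : finType) (F : {set E})
    (t h : E -> N) :
  F != set0 ->
  (forall n, #|[set e in F | (t e == n) != (h e == n)]| != 1%N) ->
  exists z : E -> K, [/\ exists e, z e != 0, forall e, e \notin F -> z e = 0
    & forall n, \sum_e z e * ((t e == n)%:R - (h e == n)%:R) = 0].
Proof.
move=> F0 deg.
have [/exists_inP[e0 e0F /eqP loop] | /exists_inPn noloop] :=
  boolP [exists e in F, t e == h e].
  exists (fun e => (e == e0)%:R); split; first by exists e0; rewrite eqxx oner_neq0.
    by move=> e; case: eqVneq => // ->; rewrite e0F.
  move=> n; apply: big1 => e _; have [-> | _] := eqVneq; last by rewrite mul0r.
  by rewrite loop subrr mulr0.
pose inc n := [set e in F | (t e == n) || (h e == n)].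
pose N' := [set n | inc n != set0].
have inc_tN e : e \in F -> t e \in N'.
  by move=> eF; rewrite inE; apply/set0Pn; exists e; rewrite inE eF eqxx.
have inc_hN e : e \in F -> h e \in N'.
  by move=> eF; rewrite inE; apply/set0Pn; exists e; rewrite inE eF eqxx orbT.
have leNF : (#|N'| <= #|F|)%N.
  (* Double counting of incidences: at least two per node, exactly two per edge. *)
  have : (\sum_(n in N') 2 <= \sum_(n in N') #|inc n|)%N.
    apply: leq_sum => n; rewrite inE -card_gt0 => gt0.
    suff : #|inc n| != 1%N by move=> ?; lia.
    suff -> : inc n = [set e in F | (t e == n) != (h e == n)] by [].
    apply/setP=> e; rewrite !inE; case eF: (e \in F) => //=.
    have := noloop _ eF; case: (eqVneq (t e) n) => [->|_ _].
      by rewrite eq_sym => /negbTE->.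
    by case: eqP.
  have -> : (\sum_(n in N') #|inc n| = \sum_(e in F) 2)%N.
    under eq_bigr do rewrite -sum1_card.
    rewrite (exchange_big_dep (mem F)) /=; last by move=> n e _; rewrite inE => /andP[].
    apply: eq_bigr => e eF; rewrite sum1_card.
    have -> : 2%N = #|[set t e; h e]| by rewrite cards2 noloop.
    apply: eq_card => n; rewrite unfold_in /= !inE eF /= ![n == _]eq_sym.
    apply: andb_idl => ten; apply/set0Pn; exists e; by rewrite inE eF.
  by rewrite !sum_nat_const => ?; lia.
pose M : 'M[K]_(#|F|, #|N'|) :=
  \matrix_(i, j) ((t (enum_val i) == enum_val j)%:R - (h (enum_val i) == enum_val j)%:R).
have ind n : n \in N' -> \sum_(k in N') (n == k)%:R = 1 :> K.
  move=> nN; rewrite (bigD1 n) //= eqxx big1 ?addr0 // => k /andP[_].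
  by rewrite eq_sym => /negbTE->.
have M1 : M *m (const_mx 1 : 'cV_#|N'|) = 0.
  apply/matrixP=> i j; rewrite !mxE.
  under eq_bigr do rewrite !mxE mulr1.
  rewrite -(big_enum_val (A := pred_of_set N')
      (fun n => (t (enum_val i) == n)%:R - (h (enum_val i) == n)%:R)) /=.
  have iF := enum_valP i.
  by rewrite sumrB !ind ?subrr ?inc_tN ?inc_hN.
have N0 : (0 < #|N'|)%N.
  by case/set0Pn: F0 => e eF; apply/card_gt0P; exists (t e); apply: inc_tN.
have rk1 : \rank (const_mx 1 : 'cV[K]_#|N'|) = 1%N.
  apply/eqP; rewrite eqn_leq rank_leq_col lt0n mxrank_eq0.
  apply/eqP => /matrixP/(_ (Ordinal N0) 0); rewrite !mxE => /eqP.
  by rewrite oner_eq0.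
have : kermx M != 0.
  rewrite kermx_eq0 /row_free neq_ltn; apply/orP; left.
  have := mulmx0_rank_max M1; rewrite rk1 => ?; lia.
case/rowV0Pn => w /sub_kermxP wM w0.
exists (fun e => \sum_(i < #|F|) w 0 i * (enum_val i == e)%:R); split.
- have [i wi] : exists i, w 0 i != 0.
    apply/existsP; apply: contraR w0 => /existsPn wn0.
    by apply/eqP/rowP=> i; rewrite mxE; apply/eqP; rewrite -[_ == _]negbK wn0.
  exists (enum_val i); rewrite (bigD1 i) //= eqxx mulr1 big1 ?addr0 // => j.
  by rewrite (inj_eq enum_val_inj) => /negbTE->; rewrite mulr0.
- move=> e eF; apply: big1 => i _; case: eqP => [h1 | _]; last by rewrite mulr0.
  by rewrite -h1 enum_valP in eF.
move=> n; under eq_bigr do rewrite mulr_suml.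
rewrite exchange_big /=.
have step (i : 'I_#|F|) : \sum_e w 0 i * (enum_val i == e)%:R * ((t e == n)%:R - (h e == n)%:R)
   = w 0 i * ((t (enum_val i) == n)%:R - (h (enum_val i) == n)%:R).
  rewrite (bigD1 (enum_val i)) //= eqxx mulr1 big1 ?addr0 // => e.
  by rewrite eq_sym => /negbTE->; rewrite mulr0 mul0r.
under eq_bigr do rewrite step.
have [nN | nN] := boolP (n \in N').
  have /rowP/(_ (enum_rank_in nN n)) := wM; rewrite !mxE => {2}<-.
  by apply: eq_bigr => i _; rewrite mxE enum_rankK_in.
apply: big1 => i _; have iF := enum_valP i.
have [et | _] := eqVneq; first by rewrite -et inc_tN in nN.
have [eh | _] := eqVneq; first by rewrite -eh inc_hN in nN.
by rewrite subrr mulr0.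
Qed.

(** * Fractional orientations, tight sets and directions of movement *)

Section FractionalOrientations.

Variables (R : archiRealFieldType) (V : finType) (A D : digraph V).

Definition dicut (U : {set V}) : bool :=
  [&& U \proper setT, U != set0 & delta_in A U == set0].

(* An arc [a] enters [U] to the extent [x a] when its reversal does, and to the
   extent [1 - x a] when [a] itself does. *)
Definition inflow (x : {ffun arc D -> R}) (U : {set V}) : R :=
  \sum_(a in delta_out D U) x a + \sum_(b in delta_in D U) (1 - x b).

Lemma inflowE (x : {ffun arc D -> R}) (U : {set V}) : inflow x U =
  \sum_a (x a * ((tail a \in U) && (head a \notin U))%:R
          + (1 - x a) * ((tail a \notin U) && (head a \in U))%:R).
Proof.
rewrite /inflow [RHS]big_split /=; congr (_ + _); rewrite big_mkcond /=;
  apply: eq_bigr => a _; rewrite inE; case: ifP => _; by rewrite ?mulr1 ?mulr0.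
Qed.

(** The slope is the net flow of [z] out of [U], so moving along [z] keeps the inflow of every set
    across which [z] has net flow zero. *)
Lemma inflow_line (x z : {ffun arc D -> R}) (s : R) (U : {set V}) :
  inflow [ffun a => x a + s * z a] U =
  inflow x U + s * \sum_a z a * ((tail a \in U)%:R - (head a \in U)%:R).
Proof.
rewrite !inflowE mulr_sumr -big_split /=; apply: eq_bigr => a _; rewrite ffunE.
by case: (tail a \in U); case: (head a \in U); rewrite /=; ring.
Qed.

Lemma dicutIU (U W : {set V}) : dicut U -> dicut W ->
  U :&: W != set0 -> U :|: W != setT -> dicut (U :&: W) && dicut (U :|: W).
Proof.
move=> /and3P[pU nU /eqP dU] /and3P[pW nW /eqP dW] hI hU.
have UW0 : U :|: W != set0.
  by apply: contra nU; rewrite setU_eq0 => /andP[].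
rewrite /dicut hI UW0 !properT hU /=.
have noin (X : {set V}) (a : arc A) : delta_in A X = set0 -> head a \in X -> tail a \in X.
  move=> dX hX; apply/negPn/negP => tX.
  have : a \in delta_in A X by rewrite inE tX hX.
  by rewrite dX inE.
rewrite -andbA; apply/and3P; split.
- move: pU; rewrite properT; apply: contra => /eqP e.
  by rewrite -subTset -e subsetIl.
- apply/eqP/setP=> a; rewrite !inE; apply/negP => /andP[/negP tX /andP[hU' hW']].
  by apply: tX; rewrite (noin U) // (noin W).
- apply/eqP/setP=> a; rewrite !inE; apply/negP.
  move=> /andP[/norP[tU tW] /orP[h|h]].
    by rewrite (noin U) in tU.
  by rewrite (noin W) in tW.
Qed.

(** Arc by arc: an arc between [U :\: W] and [W :\: U] contributes [x a + (1 - x a) = 1] on the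
    right and nothing on the left; every other arc contributes equally to both sides. *)
Lemma inflow_submod (x : {ffun arc D -> R}) (U W : {set V}) :
  (forall a, 0 <= x a <= 1) ->
  inflow x (U :&: W) + inflow x (U :|: W) <= inflow x U + inflow x W.
Proof.
move=> x01; rewrite !inflowE -!big_split /=; apply: ler_sum => a _.
have /andP[x0 x1] := x01 a; rewrite !inE.
case: (tail a \in U); case: (tail a \in W); case: (head a \in U);
  case: (head a \in W); rewrite /= ?mulr0 ?mulr1; lra.
Qed.

Definition fractional_strong (x : {ffun arc D -> R}) : Prop :=
  (forall U, dicut U -> 1 <= inflow x U) /\ (forall a, 0 <= x a <= 1).

Definition tight (x : {ffun arc D -> R}) : {set {set V}} :=
  [set U | dicut U && (inflow x U == 1)].

(** Intersection and union are again dicuts, with inflows at least 1 that sum to at most 2 by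
    submodularity; so both equal 1. *)
Lemma tight_crossing (x : {ffun arc D -> R}) :
  fractional_strong x -> crossing_family (tight x).
Proof.
move=> [xU x01] U W; rewrite !inE => /andP[dU /eqP eU] /andP[dW /eqP eW] hI hU.
have /andP[dI dUW] := dicutIU dU dW hI hU; rewrite dI dUW /=.
have := inflow_submod U W x01; have := xU _ dI; have := xU _ dUW.
by rewrite eU eW => *; apply/andP; split; apply/eqP; lra.
Qed.

Definition indegree (x : {ffun arc D -> R}) (v : V) : R :=
  \sum_a (x a * (tail a == v)%:R + (1 - x a) * (head a == v)%:R).

Lemma sum_indegree (x : {ffun arc D -> R}) (U : {set V}) :
  \sum_(v in U) indegree x v =
  \sum_a (x a * (tail a \in U)%:R + (1 - x a) * (head a \in U)%:R).
Proof.
have ind u : \sum_(v in U) (u == v)%:R = (u \in U)%:R :> R.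
  rewrite big_mkcond (bigD1 u) //= eqxx big1 ?addr0 => [|v]; first by case: ifP.
  by rewrite eq_sym => /negbTE->; case: ifP.
rewrite /indegree exchange_big; apply: eq_bigr => a _ /=.
by rewrite big_split /= -!mulr_sumr !ind.
Qed.

(** An arc inside [U] contributes [x a + (1 - x a) = 1] to the indegree sum. The difference is thus
    an integer, and integrality passes from the inflow of tight sets to a sum over vertices, to
    which [atom_weight] applies. *)
Lemma sum_indegree_inflow (x : {ffun arc D -> R}) (U : {set V}) :
  \sum_(v in U) indegree x v =
  inflow x U + \sum_(a : arc D) ((tail a \in U) && (head a \in U))%:R.
Proof.
rewrite sum_indegree inflowE -big_split /=; apply: eq_bigr => a _.
by case: (tail a \in U); case: (head a \in U); rewrite /=; ring.
Qed.

Lemma atom_indegree_int (x : {ffun arc D -> R}) (v : V) : fractional_strong x ->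
  \sum_(u in atom (tight x) v) indegree x u \is a Num.int.
Proof.
move=> hx; apply: (atom_weight v (tight_crossing hx) (mu := indegree x)) => [U|].
  rewrite inE => /andP[_ /eqP eU]; rewrite sum_indegree_inflow eU.
  by rewrite rpredD ?rpred1 // rpred_sum // => a _; rewrite rpred_nat.
have -> : \sum_u indegree x u = \sum_(u in setT) indegree x u.
  by apply: eq_bigl => u; rewrite inE.
rewrite sum_indegree rpred_sum // => a _; rewrite !inE !mulr1.
by rewrite addrC subrK rpred1.
Qed.

(** If [a0] were the only fractional arc with exactly one end in the atom, all other arcs would
    contribute integers to the indegree of the atom: a fractional arc with both ends or neither end
    inside gives 1 or 0. Since that indegree is an integer, [x a0] or [1 - x a0] would be one
    too. *)
Lemma fractional_degree (x : {ffun arc D -> R}) (n : {set V}) :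
  fractional_strong x ->
  #|[set a in [set a | 0 < x a < 1] |
      (atom (tight x) (tail a) == n) != (atom (tight x) (head a) == n)]| != 1%N.
Proof.
move=> hx; have [_ x01] := hx; apply/negP => /cards1P[a0 /setP sa0].
have := sa0 a0; rewrite !inE eqxx => /andP[fa0 ne0].
(* A set [n] that is not an atom is incident with no arc; here [a0] makes it an atom. *)
have [v nv] : exists v, n = atom (tight x) v.
  move: ne0; case: (eqVneq (atom _ (tail a0)) n) => [<- _|_]; first by exists (tail a0).
  by case: (eqVneq (atom _ (head a0)) n) => [<- _|//]; exists (head a0).
have := atom_indegree_int v hx.
rewrite sum_indegree (bigD1 a0) //= rpredDr; last first.
  rewrite rpred_sum // => a a_a0; rewrite !atom_eq -nv.
  have := sa0 a; rewrite !inE (negbTE a_a0).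
  case fa: (0 < x a < 1) => /=.
    by move/negbFE/eqP->; rewrite -mulrDl addrC subrK mul1r rpred_nat.
  move=> _; suff xa : x a \is a Num.int by rewrite rpredD ?rpredM ?rpredB ?rpred1 ?rpred_nat.
  have /andP[x0 x1] := x01 a; move: fa; rewrite lt_def x0 andbT.
  have [-> _ | _ /=] := eqVneq (x a) 0; first exact: rpred0.
  by rewrite lt_neqAle x1 andbT => /negbFE/eqP->; rewrite rpred1.
rewrite !atom_eq -nv => hint.
have xint : x a0 \is a Num.int.
  move: hint ne0; case: (_ == n); case: (_ == n) => //=.
    by rewrite mulr1 mulr0 addr0.
  rewrite mulr1 mulr0 add0r => hint _.
  by rewrite -[x a0](subKr 1) rpredB ?rpred1.
case/intrP: xint fa0 => k ->; rewrite ltr0z ltrz1; lia.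
Qed.

(** The circulation lives on the graph whose nodes are the atoms. A tight set is a union of atoms,
    so the net flow out of it is a sum of net flows at nodes, each zero. *)
Lemma fractional_direction (x : {ffun arc D -> R}) :
  fractional_strong x -> (exists a, 0 < x a < 1) ->
  exists z : {ffun arc D -> R}, [/\ exists a, z a != 0,
    forall a, ~~ (0 < x a < 1) -> z a = 0
    & {in tight x, forall U : {set V},
        \sum_a z a * ((tail a \in U)%:R - (head a \in U)%:R) = 0}].
Proof.
move=> hx [a0 fa0].
have F0 : [set a | 0 < x a < 1] != set0 by apply/set0Pn; exists a0; rewrite inE.
have [z [[a za] z0 zn]] := circulation_exists R F0 (fun n => fractional_degree n hx).
exists (finfun z); split; first by exists a; rewrite ffunE.
  by move=> b fb; rewrite ffunE z0 // inE.
move=> U UT.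
(* At most one subset [n] of [U] equals the atom of [u], and one does exactly when [u] lies in
   [U]. *)
have ind u : (u \in U)%:R = \sum_(n : {set V} | n \subset U) (atom (tight x) u == n)%:R :> R.
  have -> : (u \in U) = (atom (tight x) u \subset U).
    apply/idP/subsetP => [uU w /in_atomP->// | ]; apply.
    by rewrite atom_eq.
  rewrite big_mkcond (bigD1 (atom (tight x) u)) //= eqxx big1 ?addr0; first by case: ifP.
  by move=> n; rewrite eq_sym => /negbTE->; case: ifP.
under eq_bigr do rewrite ffunE !ind -sumrB mulr_sumr.
by rewrite exchange_big /= big1.
Qed.

End FractionalOrientations.

(** * Convex hulls and descent to smaller faces of a polytope *)

Section ConvexHull.

Variables (R : realType) (T : finType).
Implicit Types (S : {ffun T -> R} -> Prop) (x y z : {ffun T -> R}).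

Lemma sub_convex_hull S x : S x -> convex_hull S x.
Proof.
move=> Sx; exists 1%N, (fun=> 1), (fun=> x); split=> //; rewrite ?big_ord1 //.
by apply/ffunP=> i; rewrite ffunE big_ord1 mul1r.
Qed.

Lemma convex_hull_mix S x y (s t : R) :
  convex_hull S x -> convex_hull S y -> 0 <= s -> 0 <= t -> s + t = 1 ->
  convex_hull S [ffun i => s * x i + t * y i].
Proof.
move=> [n1 [w1 [p1 [w1_ge0 w1_1 Sp1 ->]]]] [n2 [w2 [p2 [w2_ge0 w2_1 Sp2 ->]]]] s0 t0 st.
exists (n1 + n2)%N.
exists (fun k => match split k with inl i => s * w1 i | inr j => t * w2 j end).
exists (fun k => match split k with inl i => p1 i | inr j => p2 j end).
have splitl i : split (lshift n2 i) = inl i :> 'I_n1 + 'I_n2 by exact: (unsplitK (inl i)).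
have splitr i : split (rshift n1 i) = inr i :> 'I_n1 + 'I_n2 by exact: (unsplitK (inr i)).
split.
- by move=> k; case: split => i; apply: mulr_ge0.
- rewrite big_split_ord /=; under eq_bigr do rewrite splitl.
  under [X in _ + X]eq_bigr do rewrite splitr.
  by rewrite -!mulr_sumr w1_1 w2_1 !mulr1.
- by move=> k; case: split.
apply/ffunP=> i; rewrite !ffunE big_split_ord /= !mulr_sumr; congr (_ + _).
  by apply: eq_bigr => k _; rewrite splitl mulrA.
by apply: eq_bigr => k _; rewrite splitr mulrA.
Qed.

Variables (C : finType) (g : C -> {ffun T -> R} -> R).

(** A ratio test: the step length is the least [g c x / - l c] over the decreasing constraints. Its
    minimizer becomes tight, no constraint is violated, and tight constraints stay tight because
    their slope is zero. *)
Lemma move_to_smaller_face x z (l : C -> R) :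
  (forall c (t : R), g c [ffun i => x i + t * z i] = g c x + t * l c) ->
  (forall c, 0 <= g c x) -> (forall c, g c x = 0 -> l c = 0) ->
  (exists c, l c < 0) ->
  exists t : R, [/\ 0 < t, forall c, 0 <= g c [ffun i => x i + t * z i]
    & (#|[set c | g c [ffun i => x i + t * z i]%R != 0%R]| < #|[set c | g c x != 0%R]|)%N].
Proof.
move=> gE gx gl [c0 lc0].
have [c1 lc1 min1] := @Order.TotalTheory.arg_minP _ _ _ c0
  (fun c => l c < 0) (fun c => g c x / - l c) lc0.
have gc1 : 0 < g c1 x.
  rewrite lt_def gx andbT; apply/eqP => /gl h; by rewrite h ltxx in lc1.
exists (g c1 x / - l c1).
have t0 : 0 < g c1 x / - l c1 by rewrite divr_gt0 // oppr_gt0.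
have g1 : g c1 x + g c1 x / - l c1 * l c1 = 0.
  by field; rewrite lt_eqF.
split=> // [c|].
  rewrite gE; case: (ltP (l c) 0) => lc; last by rewrite addr_ge0 // mulr_ge0 // ltW.
  have := min1 _ lc; rewrite ler_pdivlMr ?oppr_gt0 //.
  by rewrite mulrN -subr_ge0 opprK.
apply: proper_card; apply/properP; split.
  apply/subsetP=> c; rewrite !inE gE; apply: contra => /eqP gc.
  by rewrite gc (gl _ gc) mulr0 addr0.
by exists c1; rewrite !inE ?gE ?g1 ?eqxx // gt_eqF.
Qed.

Variable l : C -> {ffun T -> R} -> R.
Hypothesis g_line : forall c x z (t : R), g c [ffun i => x i + t * z i] = g c x + t * l c z.

(* Leaving [x] in both directions [z] and [- z] until a new constraint becomes tight
   writes [x] as a convex combination of two points of smaller faces. *)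
Lemma polytope_sub_hull S :
  (forall x, (forall c, 0 <= g c x) -> S x \/
     exists z, [/\ exists c, l c z < 0, exists c, 0 < l c z
       & forall c, g c x = 0 -> l c z = 0]) ->
  forall x, (forall c, 0 <= g c x) -> convex_hull S x.
Proof.
move=> dir x; have [n] := ubnP #|[set c | g c x != 0]|.
elim: n x => // n IHn x; rewrite ltnS => len gx.
have [Sx | [z [neg [c0 lc0] zero]]] := dir x gx; first exact: sub_convex_hull.
have [t [t0 gt ltt]] := move_to_smaller_face (fun c t => g_line c x z t) gx zero neg.
have gE' c s : g c [ffun i => x i + s * [ffun i => - z i] i] = g c x + s * - l c z.
  rewrite mulrN -mulNr -g_line; congr (g c _); apply/ffunP=> i.
  by rewrite !ffunE mulrN mulNr.
have [|| s [s0 gs lts]] := move_to_smaller_face gE' gx.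
- by move=> c /zero->; rewrite oppr0.
- by exists c0; rewrite oppr_lt0.
have hx1 := IHn _ (leq_trans ltt len) gt.
have hx2 := IHn _ (leq_trans lts len) gs.
have ts0 : 0 < t + s by rewrite addr_gt0.
have ts : t + s != 0 by rewrite gt_eqF.
(* The weights are chosen so that the displacements [t] along [z] and [s] along [- z] cancel. *)
have := convex_hull_mix hx1 hx2 (s := s / (t + s)) (t := t / (t + s)).
rewrite !divr_ge0 ?ltW // -mulrDl [s + t]addrC divff // => /(_ isT isT erefl).
congr (convex_hull S _); apply/ffunP=> i; rewrite !ffunE.
by field; rewrite ts.
Qed.

End ConvexHull.

(** * Strong orientations as the integral points *)

(** If no arc enters [U], membership in [U] propagates backwards along any path, so [U] cannot be
    reached from outside. Conversely, the vertices unreachable from [u] form a set that no arc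
    enters. *)
Lemma strong_dicutP (V : finType) (A D : digraph V) :
  strongly_connected (digraph_union A D) <->
  (forall U, dicut A U -> delta_in D U != set0).
Proof.
split=> [sc U /and3P[pU /set0Pn[v vU] /eqP dU] | cuts u v].
  have [_ [u _ uU]] := properP pU.
  apply: contraNneq uU => dD.
  have /connectP[p] := sc u v; elim: p u => [|w p IHp] u /= => [_ <- // | /andP[uw pp] lp].
  have wU := IHp w pp lp; case/existsP: uw => -[a|a] /= /andP[/eqP<- /eqP hw];
    apply/negPn/negP => tU.
    have : a \in delta_in A U by rewrite inE tU hw wU.
    by rewrite dU inE.
  have : a \in delta_in D U by rewrite inE tU hw wU.
  by rewrite dD inE.
apply/negPn/negP => nuv.
set r := connect (arc_rel (digraph_union A D)) in nuv *.
pose U := [set w | ~~ r u w].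
have step (b : arc (digraph_union A D)) : r u (tail b) -> r u (head b).
  move=> ub; apply: (connect_trans ub); apply: connect1.
  by apply/existsP; exists b; rewrite !eqxx.
have : dicut A U.
  apply/and3P; split.
  - by rewrite properT; apply/eqP => /setP/(_ u); rewrite !inE /r connect0.
  - by apply/set0Pn; exists v; rewrite inE.
  apply/eqP/setP=> a; rewrite !inE negbK; apply/negP => /andP[h /negP[]].
  exact: (step (inl a)).
move/cuts/set0Pn => [a]; rewrite !inE negbK => /andP[h /negP[]].
exact: (step (inr a)).
Qed.

Lemma inflow_vec01 (R : realType) (G : mixed_graph) (o : orientation G)
    (b : {ffun edge G -> bool}) (U : {set vertex G}) :
  @inflow R _ (oriented o) (vec01 R b) U =
  #|delta_in (oriented (reverse o [set a | b a])) U|%:R.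
Proof.
rewrite inflowE -sum1_card natr_sum [RHS]big_mkcond; apply: eq_bigr => a _ /=.
rewrite ffunE !inE /= /rev_tail /rev_head inE; case: (b a) => /=.
  rewrite subrr mul0r addr0 mul1r andbC; by case: ifP.
rewrite mul0r subr0 add0r mul1r; by case: ifP.
Qed.

Lemma SCR_inflowP (R : realType) (G : mixed_graph) (o : orientation G)
    (b : {ffun edge G -> bool}) :
  SCR o b <-> (forall U, dicut (arcs G) U -> 1 <= @inflow R _ (oriented o) (vec01 R b) U).
Proof.
rewrite /SCR /strong_orientation /=; rewrite [X in X <-> _]strong_dicutP.
by split=> h U /h; rewrite inflow_vec01 ler1n card_gt0.
Qed.

Lemma inflow_sum (R : realType) (V : finType) (D : digraph V) (n : nat)
    (w : 'I_n -> R) (p : 'I_n -> {ffun arc D -> R}) (U : {set V}) :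
  \sum_k w k = 1 ->
  inflow [ffun a => \sum_k w k * p k a] U = \sum_k w k * inflow (p k) U.
Proof.
move=> w1; rewrite inflowE.
under [RHS]eq_bigr do rewrite inflowE mulr_sumr.
rewrite [RHS]exchange_big /=; apply: eq_bigr => a _; rewrite ffunE.
have -> : 1 - \sum_k w k * p k a = \sum_k w k * (1 - p k a).
  by rewrite -[X in X - _ = _]w1 -sumrB; apply: eq_bigr => k _; ring.
rewrite !mulr_suml -big_split /=.
by apply: eq_bigr => k _; ring.
Qed.

Lemma vec01_fractional_strong (R : realType) (G : mixed_graph) (o : orientation G)
    (b : {ffun edge G -> bool}) :
  SCR o b -> @fractional_strong R _ (arcs G) (oriented o) (vec01 R b).
Proof.
move=> /(SCR_inflowP R) h; split=> // a.
by rewrite /= ffunE ler0n lern1 leq_b1.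
Qed.

Lemma integral_SCR (R : realType) (G : mixed_graph) (o : orientation G)
    (x : {ffun edge G -> R}) :
  @fractional_strong R _ (arcs G) (oriented o) x ->
  (forall a, ~~ (0 < x a < 1)) -> exists2 b, SCR o b & vec01 R b = x.
Proof.
move=> [xU x01] xint.
have e : vec01 R [ffun a => x a == 1] = x.
  apply/ffunP=> a; rewrite !ffunE; have := xint a; have /andP[x0 x1] := x01 a.
  rewrite lt_def x0 lt_neqAle x1 !andbT negb_and !negbK.
  by case/orP=> /eqP->; rewrite ?eqxx // eq_sym oner_eq0.
exists [ffun a => x a == 1] => //.
by apply/(SCR_inflowP R); rewrite e.
Qed.

(** The inequalities are affine and hold at the strong orientations, hence on the hull. Conversely,
    [polytope_sub_hull] applies: a point either has no fractional coordinate and is a strong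
    orientation, or can be moved both ways by [fractional_direction]. *)
Lemma convex_hull_SCR (R : realType) (G : mixed_graph) (o : orientation G)
    (x : {ffun edge G -> R}) :
  convex_hull (fun y => exists2 b, SCR o b & vec01 R b = y) x <->
  @fractional_strong R _ (arcs G) (oriented o) x.
Proof.
split.
  move=> [n [w [p [w0 w1 Sp ->]]]].
  have fp k : @fractional_strong R _ (arcs G) (oriented o) (p k).
    by have [b /(vec01_fractional_strong R) hb <-] := Sp k.
  split=> [U dU | a].
    rewrite inflow_sum // -[leLHS]w1; apply: ler_sum => k _.
    by rewrite ler_peMr //; apply: (fp k).1.
  rewrite ffunE; apply/andP; split.
    by apply: sumr_ge0 => k _; rewrite mulr_ge0 //; case/andP: ((fp k).2 a).
  rewrite -w1; apply: ler_sum => k _.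
  by rewrite ler_piMr //; case/andP: ((fp k).2 a).
move=> hx.
(* All constraints are indexed by one finite type; a set that is not a dicut gets the constraint
   [0 <= 0], with slope 0. *)
pose g (c : {set vertex G} + (edge G + edge G)) (y : {ffun edge G -> R}) : R :=
  match c with
  | inl U => if dicut (arcs G) U then @inflow R _ (oriented o) y U - 1 else 0
  | inr (inl a) => y a
  | inr (inr a) => 1 - y a
  end.
pose l (c : {set vertex G} + (edge G + edge G)) (z : {ffun edge G -> R}) : R :=
  match c with
  | inl U => if dicut (arcs G) U then
      \sum_a z a * ((otail o a \in U)%:R - (ohead o a \in U)%:R) else 0
  | inr (inl a) => z a
  | inr (inr a) => - z a
  end.
have gP y : (forall c, 0 <= g c y) <-> @fractional_strong R _ (arcs G) (oriented o) y.
  split=> [gy | [yU y01]].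
    split=> [U dU | a]; first by have := gy (inl U); rewrite /= dU subr_ge0.
    by have := gy (inr (inl a)); have := gy (inr (inr a)); rewrite /= subr_ge0 => -> ->.
  case=> [U | [a|a]] /=; last 2 first.
  - by case/andP: (y01 a).
  - by rewrite subr_ge0; case/andP: (y01 a).
  by case: ifP => // dU; rewrite subr_ge0 yU.
apply: (polytope_sub_hull (g := g) (l := l)); last exact/gP.
  move=> [U | [a|a]] y z t /=; rewrite ?ffunE //; last by ring.
  case: ifP => _; last by ring.
  by rewrite (@inflow_line _ _ (oriented o)) /=; ring.
move=> y /gP hy.
have [/existsP fr | /existsPn nfr] := boolP [exists a, 0 < y a < 1]; last first.
  by left; apply: integral_SCR.
right; have [z [[a za] z0 zU]] := fractional_direction hy fr.
exists z; split.
(* The two bounds on coordinate [a] have slopes [z a] and [- z a], so they provide both signs. *)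
- case: (ltgtP (z a) 0) za => // h _; first by exists (inr (inl a)).
  by exists (inr (inr a)); rewrite /= oppr_lt0.
- case: (ltgtP (z a) 0) za => // h _; last by exists (inr (inl a)).
  by exists (inr (inr a)); rewrite /= oppr_gt0.
case=> [U | [b|b]] /=.
- case: ifP => // dU /eqP; rewrite subr_eq0 => yU.
  by apply: zU; rewrite inE dU.
- by move=> yb; apply: z0; rewrite yb ltxx.
- move/eqP; rewrite subr_eq0 eq_sym => /eqP yb.
  by rewrite z0 ?oppr0 // yb ltxx andbF.
Qed.

(** * The cut inequalities as GSC inequalities, and the final description *)

Lemma delta_disjoint (V : finType) (D : digraph V) (U : {set V}) :
  [disjoint delta_out D U & delta_in D U].
Proof.
rewrite -setI_eq0; apply/eqP/setP=> a; rewrite !inE.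
by case: (tail a \in U); rewrite ?andbF.
Qed.

Definition cut_ineq (V : finType) (D : digraph V) (U : {set V}) : cube_ineq (arc D) :=
  GSC (delta_disjoint D U).

Import classical_sets.

Theorem theorem6p1 (R : realType) (G : mixed_graph) (o : orientation G) :
  convex_hull (@vec01 R (edge G) @` SCR o)%classic =
    [set x : {ffun edge G -> R} |
      (forall U : {set vertex G},
         U \proper [set: vertex G]%SET -> U != finset.set0 ->
         delta_in (arcs G) U = finset.set0 ->
         1 <= \sum_(a in delta_out (oriented o) U) x a
              + \sum_(b in delta_in (oriented o) U) (1 - x b))
      /\ (forall a : edge G, 0 <= x a <= 1)]%classic
  /\ cube_ideal R (SCR o).
Proof.
(* The image set unfolds to the predicate used in [convex_hull_SCR], so the two hulls agree by
   conversion. *)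
have hullE x : convex_hull (@vec01 R (edge G) @` SCR o)%classic x <->
    @fractional_strong R _ (arcs G) (oriented o) x := convex_hull_SCR o x.
split.
  apply/seteqP; split=> x.
    move=> /hullE[xU x01]; split=> // U pU nU dU; apply: xU.
    by rewrite /dicut pU nU dU eqxx.
  by move=> [xU x01]; apply/hullE; split=> // U /and3P[pU nU /eqP]; apply: xU.
exists ([seq Nonneg a | a <- enum (edge G)] ++ [seq AtMost1 a | a <- enum (edge G)]
  ++ [seq cut_ineq (oriented o) U | U <- enum (dicut (arcs G))]).
apply/seteqP; split=> x.
  move=> /hullE[xU x01] /=; rewrite !all_cat !all_map; apply/and3P; split.
  - by apply/allP=> a _ /=; case/andP: (x01 a).
  - by apply/allP=> a _ /=; case/andP: (x01 a).
  - by apply/allP=> U; rewrite mem_enum /=; apply: xU.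
rewrite /= !all_cat !all_map => /and3P[/allP x0 /allP x1 /allP xU]; apply/hullE; split.
  by move=> U dU; apply: (xU U); rewrite mem_enum.
move=> a; apply/andP; split; first by apply: (x0 a); rewrite -enumT mem_enum.
by apply: (x1 a); rewrite -enumT mem_enum.
Qed.
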